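(* Let $q,\beta>0$ and let $0<\alpha<1$. For every $f\in C_B(\mathbb{R})$ and every $n\in\mathbb{N}$ with $n^{1-\alpha}>2$, put $$E:=\omega\left(f,\frac1n+\frac{1}{n^{\alpha}}\right)+\frac{2\left(q+\frac1q\right)\|f\|_\infty}{e^{\beta(n^{1-\alpha}-1)}}.$$ Then $$|B_n^*(f)(x)-f(x)|\le E\quad\text{for every }x\in\mathbb{R},\qquad\text{and}\qquad \|B_n^*(f)-f\|_\infty\le E.$$ Furthermore, for every $f\in C_{UB}(\mathbb{R})$, $\lim_{n\to\infty}B_n^*(f)=f$ pointwise and uniformly on $\mathbb{R}$.
   Context: $\mathbb{N}=\{1,2,\dots\}$. For $q,\beta>0$ and $x\in\mathbb{R}$ let $\nu_{q}(x)=\frac{1-qe^{-\beta x}}{1+qe^{-\beta x}}$ and $G_{q,\beta}(x)=\frac14\left(\nu_{q}(x+1)-\nu_{q}(x-1)\right)$; $G_{1/q,\beta}$ is the same with $q$ replaced by $1/q$. Let $\Psi=\frac12\left(G_{q,\beta}+G_{1/q,\beta}\right)$ (an even probability density on $\mathbb{R}$). $C_B(\mathbb{R})$ is the set of continuous bounded real functions on $\mathbb{R}$ and $C_{UB}(\mathbb{R})$ the set of uniformly continuous bounded ones. $\|\cdot\|_\infty$ is the supremum norm on $\mathbb{R}$. For $\theta>0$, $\omega(f,\theta)=\sup\{|f(x)-f(y)|: x,y\in\mathbb{R},\ |x-y|\le\theta\}$. The (Kantorovich type) operator $B_n^*$ is $$B_n^*(f)(x)=n\int_{-\infty}^{\infty}\left(\int_0^{1/n}f\left(h+\frac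 vn\right)dh\right)\Psi(nx-v)\,dv .$$ *)

(* Defs.v *)
From mathcomp Require Import all_boot all_order all_algebra.
From mathcomp Require Import all_classical all_reals all_analysis.

Set Implicit Arguments.
Unset Strict Implicit.
Unset Printing Implicit Defensive.

Import Order.TTheory GRing.Theory Num.Theory.
Import numFieldNormedType.Exports.

Local Open Scope classical_set_scope.
Local Open Scope ring_scope.

Definition nu_fun (R : realType) (beta q x : R) : R :=
  (1 - q * expR (- beta * x)) / (1 + q * expR (- beta * x)).

Definition G_fun (R : realType) (beta q x : R) : R :=
  4^-1 * (nu_fun beta q (x + 1) - nu_fun beta q (x - 1)).

Definition Psi (R : realType) (beta q x : R) : R :=
  2^-1 * (G_fun beta q x + G_fun beta q^-1 x).

Definition C_B (R : realType) : set (R -> R) :=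
  [set f | continuous f /\ bounded_fun f].

Definition C_UB (R : realType) : set (R -> R) :=
  [set f | unif_continuous f /\ bounded_fun f].

(* [sup] of a set that is not bounded above is 0, so this is the supremum norm
   only for bounded g. *)
Definition sup_norm (R : realType) (g : R -> R) : R :=
  sup [set `|g x| | x in [set: R]].

(* The supremum for bounded f, with the same proviso as for [sup_norm]. *)
Definition modulus (R : realType) (f : R -> R) (theta : R) : R :=
  sup [set `|f p.1 - f p.2| | p in [set p : R * R | `|p.1 - p.2| <= theta]].

(* Both integrals are Lebesgue integrals; for f in [C_B] and 0 < beta, 0 < q the
   integrands are continuous and absolutely integrable, so they agree with the
   (improper) Riemann integrals.  Only n > 0 is meaningful. *)
Definition Kantorovich (R : realType) (beta q : R) (n : nat) (f : R -> R)
    (x : R) : R :=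
  n%:R * \int[lebesgue_measure]_v
    ((\int[lebesgue_measure]_(h in `[0, n%:R^-1]) f (h + v / n%:R))
     * Psi beta q (n%:R * x - v)).

(* Main.v *)
(* The function [x + (2 / beta) * ln (1 + q * e^{- beta x})] is an antiderivative
   of nu_q, so G_q has the antiderivative [G_prim], whose distance to its limit
   1/2 at T is at most q e^{- beta (T - 1)}.  As Psi is even, it follows that Psi
   has mass 1 and that its mass outside [-T, T] is at most
   (q + 1/q) e^{- beta (T - 1)}.
   After the substitution v = n x + t, B_n^*(f)(x) - f(x) is the integral against
   Psi(t) dt of the mean of f(h + x + t/n) - f(x) over h in [0, 1/n].  This mean is
   at most the modulus of f at 1/n + T/n when |t| <= T, and at most twice the
   supremum norm of f otherwise.  Taking T = n^{1 - alpha} gives the bound E. *)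
Require Import Defs.
From mathcomp Require Import all_boot all_order all_algebra.
From mathcomp Require Import all_classical all_reals all_analysis.
From mathcomp Require Import measurable_realfun ring lra.

Set Implicit Arguments.
Unset Strict Implicit.
Unset Printing Implicit Defensive.

Import Order.TTheory GRing.Theory Num.Theory.
Import numFieldNormedType.Exports.

Local Open Scope classical_set_scope.
Local Open Scope ring_scope.

(** * The density [Psi]: symmetry, antiderivative and tails *)

Definition nu_prim {R : realType} (beta q x : R) : R :=
  x + 2 / beta * ln (1 + q * expR (- beta * x)).

Definition G_prim {R : realType} (beta q x : R) : R :=
  4^-1 * (nu_prim beta q (x + 1) - nu_prim beta q (x - 1)).

Definition Psi_prim {R : realType} (beta q x : R) : R :=
  2^-1 * (G_prim beta q x + G_prim beta q^-1 x).

Section density.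
Context {R : realType}.
Variable beta : R.
Hypothesis beta_gt0 : 0 < beta.

Lemma den_gt0 q (x : R) : 0 < q -> 0 < 1 + q * expR (- beta * x).
Proof. by move=> q0; rewrite addr_gt0// mulr_gt0// expR_gt0. Qed.

(** With [x] in a single place, monotonicity and continuity can be read off factor by factor. *)
Lemma nu_funE (q x : R) : 0 < q ->
  nu_fun beta q x = 2 / (1 + q * expR (- beta * x)) - 1.
Proof.
move=> q0; rewrite /nu_fun; have := den_gt0 x q0.
by move=> /lt0r_neq0 d0; field.
Qed.

Lemma nu_fun_le (q : R) : 0 < q -> {homo nu_fun beta q : x y / x <= y}.
Proof.
move=> q0 x y xy; rewrite !nu_funE// lerD2r ler_pM2l// lef_pV2 ?posrE ?den_gt0//.
by rewrite lerD2l ler_pM2l// ler_expR !mulNr lerN2 ler_pM2l.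
Qed.

(** Multiply numerator and denominator of the left side by [q^-1 * expR (- beta * x)]. This exchange
    of [q] and [q^-1] is why [Psi] averages over both parameters. *)
Lemma nu_funN (q x : R) : 0 < q -> nu_fun beta q (- x) = - nu_fun beta q^-1 x.
Proof.
move=> q0; have qi0 : 0 < q^-1 by rewrite invr_gt0.
rewrite !nu_funE// mulrN mulNr opprK.
have /lt0r_neq0 := den_gt0 x qi0; rewrite mulNr expRN.
have := expR_gt0 (beta * x); set E := expR _ => /lt0r_neq0 E0.
move=> h; have h' : 1 + q * E != 0 by rewrite lt0r_neq0// addr_gt0// mulr_gt0// expR_gt0.
have q0' := lt0r_neq0 q0.
field; rewrite E0 q0' /=; rewrite [_ * E + _]addrC in h' |- *; rewrite ?h' ?andbT//.
Qed.

(** Reflection swaps the two summands [G_fun beta q] and [G_fun beta q^-1]. *)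
Lemma PsiN (q x : R) : 0 < q -> Psi beta q (- x) = Psi beta q x.
Proof.
move=> q0; have qi0 : 0 < q^-1 by rewrite invr_gt0.
have -> : Psi beta q (- x) = 2^-1 * (4^-1 * (nu_fun beta q (- (x - 1))
    - nu_fun beta q (- (x + 1))) + 4^-1 * (nu_fun beta q^-1 (- (x - 1))
    - nu_fun beta q^-1 (- (x + 1)))).
  by rewrite /Psi /G_fun !opprD opprK.
rewrite (nu_funN _ q0) (nu_funN _ q0) (nu_funN _ qi0) (nu_funN _ qi0).
by rewrite invrK /Psi /G_fun; field.
Qed.

Lemma Psi_ge0 (q x : R) : 0 < q -> 0 <= Psi beta q x.
Proof.
move=> q0; have qi0 : 0 < q^-1 by rewrite invr_gt0.
rewrite /Psi /G_fun mulr_ge0// addr_ge0// mulr_ge0// subr_ge0 nu_fun_le//; lra.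
Qed.

Lemma is_derive_nu_prim (q x : R) : 0 < q ->
  is_derive x 1 (nu_prim beta q) (nu_fun beta q x).
Proof.
move=> q0; have d0 := den_gt0 x q0.
have dln := is_derive1_ln d0.
have dexp : is_derive x 1 (fun y => 1 + q * expR (- beta * y))
    (q * (- beta * expR (- beta * x))).
  apply: is_derive_eq.
  rewrite /GRing.scale /=; ring.
have dc := @is_derive1_comp _ (@ln R) (fun y => 1 + q * expR (- beta * y)) _ _ _ dln dexp.
have -> : nu_fun beta q x = 1 + (2 / beta) *:
    ((1 + q * expR (- beta * x))^-1 * (q * (- beta * expR (- beta * x)))).
  rewrite /GRing.scale /= /nu_fun; have := lt0r_neq0 d0; have := lt0r_neq0 beta_gt0.
  by move=> ? ?; field; apply/andP.
apply: is_deriveD.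
Qed.

Lemma is_derive_Psi_prim (q x : R) : 0 < q ->
  is_derive x 1 (Psi_prim beta q) (Psi beta q x).
Proof.
move=> q0; have qi0 : 0 < q^-1 by rewrite invr_gt0.
have shift (p c y : R) : 0 < p ->
    is_derive y 1 (fun z => nu_prim beta p (z + c)) (nu_fun beta p (y + c)).
  move=> p0; have h := is_derive_nu_prim (y + c) p0.
  rewrite -[nu_fun _ _ _]mulr1.
  have dD : is_derive y 1 (fun z : R => z + c) 1.
    by apply: is_derive_eq; rewrite addr0.
  exact: (@is_derive1_comp _ (nu_prim beta p) (fun z => z + c) _ _ _ h dD).
have dG (p : R) : 0 < p -> is_derive x 1 (G_prim beta p) (G_fun beta p x).
  move=> p0; have h1 := shift p 1 x p0; have h2 := shift p (- 1) x p0.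
  exact: (is_deriveZ 4^-1 (is_deriveB h1 h2)).
exact: (is_deriveZ 2^-1 (is_deriveD (dG _ q0) (dG _ qi0))).
Qed.

(** Taking the factor [q * expR (beta * x)] out of the logarithm leaves a term [2 * x], which turns
    [- x] into [x], and a constant in [ln q]. *)
Lemma nu_primN (q x : R) : 0 < q ->
  nu_prim beta q (- x) = nu_prim beta q^-1 x + 2 / beta * ln q.
Proof.
move=> q0; have b0 := lt0r_neq0 beta_gt0.
have qi0 : 0 < q^-1 by rewrite invr_gt0.
rewrite /nu_prim mulrN mulNr opprK.
have -> : 1 + q * expR (beta * x)
    = expR (beta * x) * q * (1 + q^-1 * expR (- (beta * x))).
  rewrite expRN; have := lt0r_neq0 (expR_gt0 (beta * x)); have := lt0r_neq0 q0.
  by move=> ? ?; field; apply/andP.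
have h := den_gt0 x qi0; rewrite mulNr in h.
rewrite !lnM ?posrE ?mulr_gt0 ?expR_gt0// expRK -mulNr.
by field.
Qed.

(** By reflection the values of [nu_prim] at 1 cancel crosswise between [q] and [q^-1], and so do
    [ln q] and [ln q^-1]. Hence [Psi] has mass exactly 1/2 on the positive half-line. *)
Lemma Psi_prim0 (q : R) : 0 < q -> Psi_prim beta q 0 = 0.
Proof.
move=> q0; have qi0 : 0 < q^-1 by rewrite invr_gt0.
rewrite /Psi_prim /G_prim !add0r (nu_primN _ q0) (nu_primN _ qi0) invrK.
by rewrite lnV ?posrE//; field; exact: lt0r_neq0.
Qed.

(* [2^-1 - G_prim beta q x] is [(2 * beta)^-1 * ln (A / B)] with
   [A = 1 + q * expR (- beta * (x - 1))] and
   [B = 1 + q * expR (- beta * (x + 1))]; then [ln (A / B) <= A - B]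
   because [1 <= B]. *)
Lemma G_prim_tail (q x : R) : 0 < q ->
  0 <= 2^-1 - G_prim beta q x <= q * expR (- (beta * (x - 1))).
Proof.
move=> q0; rewrite /G_prim /nu_prim.
have a0 := den_gt0 (x - 1) q0; have b0 := den_gt0 (x + 1) q0.
have eab : expR (- beta * (x + 1)) = expR (- beta * (x - 1)) * expR (- (2 * beta)).
  by rewrite -expRD; congr expR; ring.
rewrite -[- (beta * (x - 1))]mulNr.
set A := 1 + _ in a0 *; set B := 1 + _ in b0 *.
have -> : 2^-1 - 4^-1 * (x + 1 + 2 / beta * ln B - (x - 1 + 2 / beta * ln A))
    = (2 * beta)^-1 * ln (A / B).
  by rewrite ln_div ?posrE//; field; exact: lt0r_neq0.
have E0 := expR_gt0 (- beta * (x - 1)).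
have BA : B <= A.
  rewrite /A /B eab lerD2l ler_pM2l// ler_piMr ?(ltW E0)// -[leRHS]expR0 ler_expR.
  by rewrite oppr_le0 mulr_ge0// ltW.
have b2 : 0 < 2 * beta by rewrite mulr_gt0.
have B1 : 1 <= B by rewrite /B lerDl mulr_ge0 ?ltW// expR_gt0.
apply/andP; split.
  by rewrite mulr_ge0 ?invr_ge0 ?(ltW b2)// ln_ge0// ler_pdivlMr// mul1r.
rewrite mulrC ler_pdivrMr//.
have -> : A / B = 1 + (A - B) / B by field; exact: lt0r_neq0.
have AB0 : 0 <= (A - B) / B by rewrite divr_ge0 ?subr_ge0// ltW.
apply: (le_trans (le_ln1Dx _)); first by rewrite (lt_le_trans _ AB0)// ltrN10.
apply: (@le_trans _ _ (A - B)); first by rewrite ler_pdivrMr// ler_peMr// subr_ge0.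
have -> : A - B = q * expR (- beta * (x - 1)) * (1 - expR (- (2 * beta))).
  by rewrite /A /B eab; ring.
rewrite ler_pM2l ?mulr_gt0//.
have := expR_ge1Dx (- (2 * beta)); lra.
Qed.

Lemma Psi_prim_tail (q x : R) : 0 < q ->
  0 <= 2^-1 - Psi_prim beta q x
    <= 2^-1 * (q + q^-1) * expR (- (beta * (x - 1))).
Proof.
move=> q0; have qi0 : 0 < q^-1 by rewrite invr_gt0.
have /andP[? ?] := G_prim_tail x q0; have /andP[? ?] := G_prim_tail x qi0.
rewrite /Psi_prim; apply/andP; split; first lra.
rewrite -mulrA mulrDl; lra.
Qed.

Lemma cvg_Psi_prim (q : R) : 0 < q -> Psi_prim beta q x @[x --> +oo] --> (2^-1 : R).
Proof.
move=> q0.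
have e0 : expR (- (beta * (x - 1))) @[x --> +oo] --> (0 : R).
  apply: (@cvg_comp _ _ _ (fun x => beta * (x - 1)) (fun y => expR (- y)) _
    (pinfty_nbhs R)); last exact: cvgr_expR.
  apply: gt0_cvgMry => //; exact: cvg_addrr.
have l : 2^-1 - 2^-1 * (q + q^-1) * expR (- (beta * (x - 1))) @[x --> +oo] --> (2^-1 : R).
  rewrite -[X in _ --> X]subr0; apply: cvgB; first exact: cvg_cst.
  by rewrite -(mulr0 (2^-1 * (q + q^-1))); apply: cvgM => //; exact: cvg_cst.
apply: (squeeze_cvgr _ l (cvg_cst _)).
near=> x; have := Psi_prim_tail x q0; lra.
Unshelve. all: by end_near. Qed.

Lemma continuous_Psi (q : R) : 0 < q -> continuous (Psi beta q).
Proof.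
move=> q0; have qi0 : 0 < q^-1 by rewrite invr_gt0.
have cnu p c : 0 < p -> continuous (fun x => nu_fun beta p (x + c)).
  move=> p0 x; apply: (@continuous_comp _ _ _ (fun x => x + c) (nu_fun beta p)).
    by apply: cvgD; [exact: cvg_id|exact: cvg_cst].
  rewrite (_ : nu_fun beta p = fun y => 2 / (1 + p * expR (- beta * y)) - 1); last first.
    by apply/funext => y; exact: nu_funE.
  have ce : {for x + c, continuous (fun y => 1 + p * expR (- beta * y))}.
    apply: cvgD; first exact: cvg_cst.
    apply: cvgM; first exact: cvg_cst.
    apply: (@continuous_comp _ _ _ (fun y => - beta * y) expR).
      by apply: cvgM; [exact: cvg_cst|exact: cvg_id].
    exact: continuous_expR.
  apply: cvgD; last exact: cvg_cst.
  apply: cvgM; first exact: cvg_cst.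
  by apply: cvgV => //; rewrite lt0r_neq0// den_gt0.
move=> x; apply: cvgM; first exact: cvg_cst.
by apply: cvgD; (apply: cvgM; first exact: cvg_cst); apply: cvgB; exact: cnu.
Qed.

End density.

(** * Integrals against [Psi] *)

Section integral_Psi.
Context {R : realType}.
Variables beta q : R.
Hypothesis beta_gt0 : 0 < beta.
Hypothesis q_gt0 : 0 < q.
Notation mu := (@lebesgue_measure R).

Lemma measurable_Psi (D : set R) : measurable_fun D (fun x => (Psi beta q x)%:E).
Proof.
apply/measurable_EFinP; apply: measurable_funTS; apply: continuous_measurable_fun.
exact: continuous_Psi.
Qed.

(** The fundamental theorem of calculus on a half-line, where 1/2 is the limit of [Psi_prim] at
    infinity. *)
Lemma integral_Psi_right (T : R) :
  (\int[mu]_(x in `[T, +oo[) (Psi beta q x)%:E = (2^-1 - Psi_prim beta q T)%:E)%E.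
Proof.
have dP x : derivable (Psi_prim beta q) x 1.
  exact: (@ex_derive _ _ _ _ _ _ _ (is_derive_Psi_prim beta_gt0 x q_gt0)).
rewrite (@ge0_continuous_FTC2y _ _ (Psi_prim beta q) _ 2^-1)//.
- by move=> x _; exact: Psi_ge0.
- by apply: continuous_subspaceT; exact: continuous_Psi.
- exact: cvg_Psi_prim.
- apply: cvg_at_right_filter; apply: differentiable_continuous.
  exact/derivable1_diffP.
- move=> x _; rewrite derive1E.
  exact: (@derive_val _ _ _ _ _ _ _ (is_derive_Psi_prim beta_gt0 x q_gt0)).
Qed.

Lemma integral_Psi_left (T : R) :
  (\int[mu]_(x in `]-oo, (- T)%R]) (Psi beta q x)%:E
   = (2^-1 - Psi_prim beta q T)%:E)%E.
Proof.
rewrite ge0_integration_by_substitutionNy.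
- rewrite -integral_Psi_right; apply: eq_integral => x _ /=.
  by rewrite PsiN.
- by apply: continuous_subspaceT; exact: continuous_Psi.
- by move=> x _; exact: Psi_ge0.
Qed.

Lemma integral_Psi : (\int[mu]_x (Psi beta q x)%:E = 1)%E.
Proof.
rewrite ge0_symfun_integralT.
- rewrite -set_itvcy integral_Psi_right Psi_prim0// subr0 -EFinM.
  by rewrite divff// pnatr_eq0.
- by move=> x; exact: Psi_ge0.
- exact: continuous_Psi.
- by move=> x /=; rewrite PsiN.
Qed.

(** Bound [k] by [w] everywhere plus [M] on each of the two tails; then use that [Psi] has mass 1
    and small tails. With extended-real integrals of nonnegative functions, measurability suffices
    for comparison and additivity. *)
Lemma integral_mul_Psi_le (k : R -> R) (w M T : R) :
  measurable_fun setT k -> (forall t, 0 <= k t) ->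
  (forall t, `|t| <= T -> k t <= w) -> (forall t, k t <= M) ->
  0 <= w -> 0 <= M ->
  (\int[mu]_t (k t * Psi beta q t)%:E
   <= (w + M * ((q + q^-1) * expR (- (beta * (T - 1)))))%:E)%E.
Proof.
move=> mk k0 kw kM w0 M0.
pose A := `]-oo, (- T)]%classic; pose B := `[T, +oo[%classic.
pose far (D : set R) := ((fun t => M%:E * (Psi beta q t)%:E) \_ D)%E.
have Psi0 t : 0 <= Psi beta q t by exact: Psi_ge0.
have MPsi0 t : (0 <= M%:E * (Psi beta q t)%:E)%E by rewrite -EFinM lee_fin mulr_ge0.
have far0 D t : (0 <= far D t)%E by rewrite /far/patch; case: ifPn.
have mMPsi D : measurable_fun D (fun t => M%:E * (Psi beta q t)%:E)%E.
  by apply: measurable_funeM; exact: measurable_Psi.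
have mfar D : measurable D -> measurable_fun setT (far D).
  by move=> mD; apply/(measurable_restrictT _ _).1.
have mA : measurable A by exact: measurable_itv.
have mB : measurable B by exact: measurable_itv.
have mwPsi : measurable_fun setT (fun t => w%:E * (Psi beta q t)%:E)%E.
  by apply: measurable_funeM; exact: measurable_Psi.
have wPsi0 t : (0 <= w%:E * (Psi beta q t)%:E)%E by rewrite -EFinM lee_fin mulr_ge0.
have farE D : measurable D ->
    (\int[mu]_t far D t = M%:E * \int[mu]_(t in D) (Psi beta q t)%:E)%E.
  move=> mD; rewrite -integral_mkcond ge0_integralZl//.
  - exact: measurable_Psi.
  - by move=> t _; rewrite lee_fin.
apply: (@le_trans _ _ (\int[mu]_t (w%:E * (Psi beta q t)%:E + (far A t + far B t)))%E).
  apply: ge0_le_integral => //.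
  - by move=> t _; rewrite lee_fin mulr_ge0.
  - apply/measurable_EFinP; apply: measurable_funM => //.
    by apply/measurable_EFinP; exact: measurable_Psi.
  - by apply: emeasurable_funD => //; apply: emeasurable_funD; exact: mfar.
  - move=> t _; have [tT|tT] := leP `|t| T.
      rewrite -[leLHS]adde0; apply: leeD; last by rewrite adde_ge0.
      by rewrite -EFinM lee_fin ler_wpM2r// kw.
    apply: (@le_trans _ _ (M%:E * (Psi beta q t)%:E)%E).
      by rewrite -EFinM lee_fin ler_wpM2r.
    apply: (@le_trans _ _ (far A t + far B t)%E); last by rewrite leeDr.
    (* A point with [T < |t|] lies in one of the half-lines, and the term of the other one is
       nonnegative. *)
    have [tA|tB] : A t \/ B t.
      rewrite /A /B /= !in_itv /= andbT.
      have [t0|t0] := leP 0 t; move: tT.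
        by rewrite ger0_norm// => /ltW; right.
      by rewrite ltr0_norm// ltrNr => /ltW; left.
      by rewrite {1}/far patchT ?inE// leeDl.
    by rewrite {2}/far patchT ?inE// leeDr.
rewrite ge0_integralD//; last 2 first.
  by move=> t _; rewrite adde_ge0.
  by apply: emeasurable_funD; exact: mfar.
rewrite ge0_integralD//; [|exact: mfar..].
rewrite !farE// integral_Psi_left integral_Psi_right.
rewrite ge0_integralZl//; [|exact: measurable_Psi|by move=> t _; rewrite lee_fin].
rewrite integral_Psi mule1 -!EFinM -!EFinD lee_fin lerD2l -mulrDr ler_wpM2l//.
(* Each tail contributes half of the factor [q + q^-1]. *)
have /andP[_] := Psi_prim_tail beta_gt0 T q_gt0.
rewrite -mulrA; lra.
Qed.

(** A translation is an increasing substitution with derivative 1. *)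
Lemma ge0_integral_shift (g : R -> R) (c : R) : continuous g -> (forall x, 0 <= g x) ->
  (\int[mu]_x (g x)%:E = \int[mu]_x (g (x + c))%:E)%E.
Proof.
move=> cg g0.
have dS (x : R) : is_derive x 1 (fun z : R => z + c) 1.
  by apply: is_derive_eq; rewrite addr0.
have D1 : derive1 (fun z : R => z + c) = cst 1.
  by apply/funext => z; rewrite derive1E derive_val.
rewrite (@increasing_ge0_integration_by_substitutionT _ (fun z => z + c))//.
- by apply: eq_integral => x _; rewrite D1 /= fctE /= mulr1.
- by move=> x y; rewrite ltrD2r.
- by rewrite D1; exact: cst_continuous.
- by rewrite D1; exact: is_cvg_cst.
- by rewrite D1; exact: is_cvg_cst.
- exact: cvg_addrr_Ny.
- exact: cvg_addrr.
Qed.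

Lemma continuous_Psi_reflect (c : R) : continuous (fun v => Psi beta q (c - v)).
Proof.
move=> v; apply: (@continuous_comp _ _ _ (fun v => c - v) (Psi beta q)).
  by apply: cvgB; [exact: cvg_cst|exact: cvg_id].
exact: continuous_Psi.
Qed.

(** Substitute [v = t + c]; the argument of [Psi] becomes [- t], and [Psi] is even. *)
Lemma integral_mul_Psi_shift (k : R -> R) (c : R) :
  continuous k -> (forall x, 0 <= k x) ->
  (\int[mu]_v (k v * Psi beta q (c - v))%:E
   = \int[mu]_t (k (t + c) * Psi beta q t)%:E)%E.
Proof.
move=> ck k0; rewrite (@ge0_integral_shift _ c).
- apply: eq_integral => t _; congr (_ * _)%:E.
  by rewrite -PsiN//; congr Psi; ring.
- by move=> v; apply: cvgM; [exact: ck|exact: continuous_Psi_reflect].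
- by move=> v; rewrite mulr_ge0// Psi_ge0.
Qed.

Lemma integral_Psi_shift (c : R) : (\int[mu]_v (Psi beta q (c - v))%:E = 1)%E.
Proof.
rewrite -integral_Psi; transitivity (\int[mu]_v (1 * Psi beta q (c - v))%:E)%E.
  by apply: eq_integral => v _; rewrite mul1r.
rewrite (@integral_mul_Psi_shift (cst 1)) /=.
- by apply: eq_integral => v _; rewrite mul1r.
- exact: cst_continuous.
- by [].
Qed.

Lemma integrable_Psi_shift (c : R) :
  mu.-integrable setT (EFin \o (fun v => Psi beta q (c - v))).
Proof.
apply/integrableP; split.
  apply/measurable_EFinP; apply: continuous_measurable_fun.
  exact: continuous_Psi_reflect.
apply: le_lt_trans (ltry 1); rewrite -(integral_Psi_shift c) le_eqVlt.
apply/orP; left; apply/eqP; apply: eq_integral => v _ /=.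
by rewrite ger0_norm// Psi_ge0.
Qed.

End integral_Psi.

(** * Supremum norm and modulus of continuity *)

Section sup_norm_modulus.
Context {R : realType}.
Implicit Types f g : R -> R.

Lemma bounded_fun_ub f : bounded_fun f -> exists M, forall x, `|f x| <= M.
Proof.
(* [bounded_fun] provides as bounds only the reals strictly above [M]. *)
move=> [M [_ h]]; exists (M + 1) => x; apply: (h (M + 1)) => //.
by rewrite ltrDl.
Qed.

(** Boundedness excludes the default value 0 of [sup]. *)
Lemma normr_le_sup_norm f (x : R) : bounded_fun f -> `|f x| <= sup_norm f.
Proof.
move=> /bounded_fun_ub[M fM]; apply: ub_le_sup; last by exists x.
by exists M => _ [y _ <-].
Qed.

Lemma sup_norm_le g (E : R) : (forall x, `|g x| <= E) -> sup_norm g <= E.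
Proof.
move=> gE; apply: ge_sup; first by exists `|g 0|, 0.
by move=> _ [x _ <-].
Qed.

Lemma dist_le_modulus f (d x y : R) : bounded_fun f ->
  `|x - y| <= d -> `|f x - f y| <= modulus f d.
Proof.
move=> /bounded_fun_ub[M fM] xyd; apply: ub_le_sup; last by exists (x, y).
exists (M + M) => _ [p _ <-].
by apply: le_trans (ler_normB _ _) _; apply: lerD.
Qed.

Lemma modulus_ge0 f (d : R) : bounded_fun f -> 0 <= d -> 0 <= modulus f d.
Proof.
by move=> bf d0; apply: le_trans (@dist_le_modulus f d 0 0 bf _); rewrite ?subrr ?normr0.
Qed.

End sup_norm_modulus.

(** * Means of [f] over intervals of length [1/n] *)

Section local_average.
Context {R : realType}.
Notation mu := (@lebesgue_measure R).
Variables (f : R -> R) (n : nat).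
Hypothesis n_gt0 : (0 < n)%N.

Local Notation I := `[0, n%:R^-1]%classic.

Let n0 : 0 < n%:R :> R. Proof. by rewrite ltr0n. Qed.

Let muI : mu I = (n%:R^-1)%:E.
Proof. by rewrite lebesgue_measure_itv /= lte_fin invr_gt0 n0 oppr0 adde0. Qed.

(** The mean of [f] over [[v/n, (v+1)/n]]: the outer factor [n] of the operator is the reciprocal of
    the length, so the operator integrates these means against [Psi]. *)
Definition average (v : R) : R := n%:R * \int[mu]_(h in I) f (h + v / n%:R).

Lemma integrable_cst_itv (a : R) : mu.-integrable I (EFin \o cst a).
Proof.
apply: measurable_bounded_integrable => //.
- by rewrite /= muI ltry.
- exact: bounded_cst.
Qed.

Hypothesis cf : continuous f.

Let cfs (c : R) : continuous (fun h => f (h + c)).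
Proof.
move=> h; apply: (@continuous_comp _ _ _ (fun h => h + c) f); last exact: cf.
by apply: cvgD; [exact: cvg_id|exact: cvg_cst].
Qed.

Lemma integrable_shift (c : R) : mu.-integrable I (EFin \o (fun h => f (h + c))).
Proof.
apply: continuous_compact_integrable; first exact: segment_compact.
exact/continuous_subspaceT/cfs.
Qed.

(** The mean fixes constants, so [a] can be subtracted under the integral. The case [a = f x] gives
    the local estimate, and [a = 0] a bound on the mean itself. *)
Lemma average_dist (v a B : R) :
  (forall h, 0 <= h <= n%:R^-1 -> `|f (h + v / n%:R) - a| <= B) ->
  `|average v - a| <= B.
Proof.
move=> hB; have nz := lt0r_neq0 n0.
have ia : \int[mu]_(h in I) a = a / n%:R.
  by rewrite Rintegral_cst//= muI.
have -> : average v - a = n%:R * \int[mu]_(h in I) (f (h + v / n%:R) - a).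
  rewrite RintegralB//; [|exact: integrable_shift|exact: integrable_cst_itv].
  by rewrite ia mulrBr [n%:R * (a / _)]mulrC divfK.
have iB : mu.-integrable I (EFin \o (fun h => f (h + v / n%:R) - a)).
  rewrite (_ : _ \o _ = (EFin \o (fun h => f (h + v / n%:R))) \- (EFin \o cst a))%E//.
  by apply: integrableB => //; [exact: integrable_shift|exact: integrable_cst_itv].
rewrite normrM (gtr0_norm n0) -(@ler_pM2l _ n%:R^-1) ?invr_gt0// mulKf//.
apply: (le_trans (le_normr_Rintegral _ iB)) => //.
rewrite -[X in _ <= X](_ : \int[mu]_(h in I) B = n%:R^-1 * B); last first.
  by rewrite Rintegral_cst//= muI mulrC.
apply: le_Rintegral => //.
- exact: integrable_norm.
- exact: integrable_cst_itv.
Qed.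

(** Continuity under the integral sign, on a window around [a]: the constant [M] dominates and is
    integrable on an interval of finite length. *)
Lemma continuous_average (M : R) : (forall x, `|f x| <= M) -> continuous average.
Proof.
move=> fM a; apply: cvgM; first exact: cvg_cst.
apply: (@continuity_under_integral R _ _ mu (fun v h => f (h + v / n%:R)) I _
  (a - 1) (a + 1) _ _ (cst M)) => //.
- by move=> v _; exact: integrable_shift.
- apply: aeW => h _ v _.
  apply: (@continuous_comp _ _ _ (fun v : R => (h : R) + v / n%:R) f); last exact: cf.
  apply: cvgD; first exact: cvg_cst.
  by apply: cvgM; [exact: cvg_id|exact: cvg_cst].
- exact: integrable_cst_itv.
- by move=> v _; apply: aeW => h _; exact: fM.
- by rewrite inE /= in_itv /=; lra.
Qed.

End local_average.

(** * The quantitative estimate *)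

Section Kantorovich_bound.
Context {R : realType}.
Notation mu := (@lebesgue_measure R).
Variables (beta q : R).
Hypothesis beta_gt0 : 0 < beta.
Hypothesis q_gt0 : 0 < q.

(** The cut-off [T], the local bound [w] and the global bound [M] stay free, so that the estimate
    serves both the bound by the modulus and the uniform limit. *)
Lemma Kantorovich_dist (f : R -> R) (n : nat) (x T w M : R) :
  continuous f -> (0 < n)%N -> 0 <= w -> (forall y, `|f y| <= M) ->
  (forall y, `|y - x| <= n%:R^-1 + T / n%:R -> `|f y - f x| <= w) ->
  `|Kantorovich beta q n f x - f x|
    <= w + 2 * M * ((q + q^-1) * expR (- (beta * (T - 1)))).
Proof.
move=> cf n0 w0 fM fw; set c := n%:R * x.
have n0' : 0 < n%:R :> R by rewrite ltr0n.
have nz := lt0r_neq0 n0'.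
have M0 : 0 <= M by apply: le_trans (fM 0).
have cg := continuous_average n0 cf fM; set g := average f n in cg.
have gM v : `|g v| <= M.
  by rewrite -[g v]subr0; apply: average_dist => // h _; rewrite subr0.
have iPsi := integrable_Psi_shift beta_gt0 q_gt0 c.
have igPsi : mu.-integrable setT (EFin \o (fun v => g v * Psi beta q (c - v))).
  rewrite (_ : _ \o _ = (EFin \o g) \* (EFin \o (fun v => Psi beta q (c - v))))%E//.
  apply: integrableMr => //; first exact: continuous_measurable_fun.
  by exists M; split; [exact: num_real|move=> r Mr v _ /=; exact: le_trans (gM v) (ltW Mr)].
have ifPsi : mu.-integrable setT (EFin \o (fun v => f x * Psi beta q (c - v))).
  exact: (integrableZl measurableT (f x) iPsi).
have KE : Kantorovich beta q n f x = \int[mu]_v (g v * Psi beta q (c - v)).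
  rewrite /Kantorovich -RintegralZl//.
    by apply: eq_Rintegral => v _; rewrite mulrA.
  have -> : (fun v => (\int[mu]_(h in `[0, n%:R^-1]) f (h + v / n%:R))
        * Psi beta q (n%:R * x - v))
      = (fun v => n%:R^-1 * (g v * Psi beta q (c - v))).
    by apply/funext => v; rewrite /g /average -/c !mulrA mulVf// mul1r.
  exact: (integrableZl measurableT n%:R^-1 igPsi).
(* The reflected and translated density still has mass 1. *)
have fE : f x = \int[mu]_v (f x * Psi beta q (c - v)).
  by rewrite RintegralZl// /Rintegral integral_Psi_shift// mulr1.
rewrite KE [in X in _ - X]fE -RintegralB//.
rewrite -lee_fin EFin_normr_Rintegral//; last exact: (integrableB measurableT igPsi ifPsi).
have mk : continuous (fun v => `|g v - f x|).
  move=> v; apply: cvg_norm; apply: cvgB; [exact: cg|exact: cvg_cst].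
apply: le_trans (le_abse_integral _ _ _) _ => //.
  apply/measurable_EFinP; apply: continuous_measurable_fun => v.
  apply: cvgB; apply: cvgM; [exact: cg| |exact: cvg_cst|];
    exact: continuous_Psi_reflect.
have -> : (\int[mu]_v `|(g v * Psi beta q (c - v) - f x * Psi beta q (c - v))%:E|
    = \int[mu]_v (`|g v - f x| * Psi beta q (c - v))%:E)%E.
  apply: eq_integral => v _.
  by rewrite -mulrBl abse_EFin normrM [X in _ * X]ger0_norm// Psi_ge0.
rewrite (integral_mul_Psi_shift beta_gt0 q_gt0 c mk)//.
apply: integral_mul_Psi_le => //.
- apply: continuous_measurable_fun => t.
  apply: (@continuous_comp _ _ _ (fun t => t + c) (fun v => `|g v - f x|)); last exact: mk.
  by apply: cvgD; [exact: cvg_id|exact: cvg_cst].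
- move=> t tT; apply: average_dist => // h /andP[h0 hn]; apply: fw.
  (* As [c = n x], the sample point is [x + h + t/n], within [1/n + T/n] of [x]. *)
  have -> : h + (t + c) / n%:R - x = h + t / n%:R by rewrite /c; field.
  apply: le_trans (ler_normD _ _) _; apply: lerD; first by rewrite ger0_norm.
  by rewrite normrM [X in _ * X]gtr0_norm ?invr_gt0// ler_pM2r ?invr_gt0.
- move=> t; apply: le_trans (ler_normB _ _) _.
  by rewrite mulr_natl mulr2n lerD.
- by rewrite mulr_ge0.
Qed.

Lemma Kantorovich_modulus (alpha : R) (f : R -> R) (n : nat) (x : R) :
  C_B f -> (0 < n)%N ->
  `|Kantorovich beta q n f x - f x|
    <= modulus f (n%:R^-1 + (n%:R `^ alpha)^-1)
       + 2 * (q + q^-1) * sup_norm f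
         / expR (beta * (n%:R `^ (1 - alpha) - 1)).
Proof.
move=> [cf bf] n0; have n0' : 0 < n%:R :> R by rewrite ltr0n.
set d := (X in modulus f X); have d0 : 0 <= d by rewrite addr_ge0 ?invr_ge0 ?ler0n ?powR_ge0.
(* The cut-off [T] is the power of [n] with exponent [1 - alpha], so [T/n] is the power with
   exponent [- alpha]. *)
have dE : d = n%:R^-1 + n%:R `^ (1 - alpha) / n%:R.
  by rewrite /d powRB ?(gt_eqF n0') ?implybT// powRr1 ?ler0n// mulrAC divff ?mul1r// gt_eqF.
rewrite -expRN.
have -> : 2 * (q + q^-1) * sup_norm f * expR (- (beta * (n%:R `^ (1 - alpha) - 1)))
  = 2 * sup_norm f * ((q + q^-1) * expR (- (beta * (n%:R `^ (1 - alpha) - 1)))) by ring.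
apply: Kantorovich_dist => //.
- exact: modulus_ge0.
- by move=> y; exact: normr_le_sup_norm.
- by rewrite -dE => y; exact: dist_le_modulus.
Qed.

End Kantorovich_bound.

(** * Convergence for uniformly continuous [f] *)

Section uniform_convergence.
Context {R : realType}.
Implicit Type f : R -> R.

Lemma unif_continuous_dist f (e : R) : unif_continuous f -> 0 < e ->
  exists2 d, 0 < d & forall x y, `|x - y| < d -> `|f x - f y| < e.
Proof.
move=> /unif_continuousP uf /uf[d d0 h]; exists d => // x y xy.
exact: (h (x, y) xy).
Qed.

Lemma unif_continuous_continuous f : unif_continuous f -> continuous f.
Proof.
move=> uf x; apply/cvgrPdist_lt => e e0.
have [d d0 h] := unif_continuous_dist uf e0.
by near=> y; apply: h; near: y; exact: cvgr_dist_lt.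
Unshelve. all: by end_near. Qed.

(** Half of [e] goes to the local oscillation and half to the tail. The rank of [n] does not depend
    on [x], so both modes of convergence follow. *)
Lemma near_Kantorovich_dist (beta q : R) f (e : R) :
  0 < beta -> 0 < q -> C_UB f -> 0 < e ->
  \forall n \near \oo, forall x, `|f x - Kantorovich beta q n f x| < e.
Proof.
move=> beta0 q0 [uf bf] e0; have cf := unif_continuous_continuous uf.
have [M fM] := bounded_fun_ub bf.
have e20 : 0 < e / 2 by rewrite divr_gt0.
have [d d0 fd] := unif_continuous_dist uf e20.
have d20 : 0 < d / 2 by rewrite divr_gt0.
(* This is the tail term for [T = n * (d / 2)]: then [T/n] is [d / 2], and the other half of [d] is
   left for [1/n]. *)
have tail0 : 2 * M * ((q + q^-1) * expR (- (beta * (n%:R * (d / 2) - 1))))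
    @[n --> \oo] --> (0 : R).
  apply: (@cvg_comp _ _ _ (fun n : nat => n%:R : R)
    (fun y => 2 * M * ((q + q^-1) * expR (- (beta * (y * (d / 2) - 1)))))
    _ (pinfty_nbhs R)); first exact: cvgr_idn.
  rewrite -(mulr0 (2 * M)); apply: cvgM; first exact: cvg_cst.
  rewrite -[X in _ --> X](mulr0 (q + q^-1)); apply: cvgM; first exact: cvg_cst.
  apply: (@cvg_comp _ _ _ (fun y => beta * (y * (d / 2) - 1))
    (fun y => expR (- y)) _ (pinfty_nbhs R)); last exact: cvgr_expR.
  apply: gt0_cvgMry => //.
  apply: (@cvg_comp _ _ _ (fun y => y * (d / 2)) (fun y => y - 1) _
    (pinfty_nbhs R)); last exact: cvg_addrr.
  by apply: gt0_cvgMly => //; exact: cvg_id.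
(* Uniform continuity allows [T] proportional to [n] in [Kantorovich_dist], so
   that no real powers of [n] occur. *)
near=> n => x; have n0 : (0 < n)%N by near: n; exact: nbhs_infty_gt.
have n0' : 0 < n%:R :> R by rewrite ltr0n.
rewrite distrC; apply: le_lt_trans.
  apply: (@Kantorovich_dist _ _ _ beta0 q0 f n x (n%:R * (d / 2)) (e / 2) M) => //.
    exact: ltW.
  move=> y yx; apply/ltW/fd/(le_lt_trans yx).
  have -> : n%:R * (d / 2) / n%:R = d / 2 by field; rewrite gt_eqF.
  suff : n%:R^-1 < d / 2 by lra.
  rewrite invf_plt ?posrE//; near: n; exact: nbhs_infty_gtr.
have : 2 * M * ((q + q^-1) * expR (- (beta * (n%:R * (d / 2) - 1)))) < e / 2.
  by near: n; exact: (cvgr_lt _ tail0).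
lra.
Unshelve. all: by end_near. Qed.

End uniform_convergence.

Theorem theorem3 (R : realType) (q beta alpha : R)
    (q_gt0 : 0 < q) (beta_gt0 : 0 < beta)
    (alpha_gt0 : 0 < alpha) (alpha_lt1 : alpha < 1) :
  (forall (f : R -> R) (n : nat),
      C_B f -> (0 < n)%N -> 2 < n%:R `^ (1 - alpha) ->
      let E := modulus f (n%:R^-1 + (n%:R `^ alpha)^-1)
               + 2 * (q + q^-1) * sup_norm f
                 / expR (beta * (n%:R `^ (1 - alpha) - 1)) in
      (forall x : R, `|Kantorovich beta q n f x - f x| <= E) /\
      sup_norm (fun x => Kantorovich beta q n f x - f x) <= E) /\
  (forall f : R -> R,
      C_UB f ->
      (forall x : R, Kantorovich beta q n f x @[n --> \oo] --> f x) /\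
      {uniform, (fun n : nat => Kantorovich beta q n f) @ \oo --> f}).
Proof.
split.
  move=> f n Cf n0 _ E.
  have KE x : `|Kantorovich beta q n f x - f x| <= E by exact: Kantorovich_modulus.
  by split=> //; exact: sup_norm_le.
move=> f Cf; split.
  move=> x; apply/cvgrPdist_lt => e e0.
  by apply: filterS (near_Kantorovich_dist beta_gt0 q_gt0 Cf e0) => n; apply.
(* A neighbourhood of [f] for uniform convergence contains all functions [E]-close to [f] for some
   entourage [E], and [E] contains the pairs at distance below some [e]. *)
move=> P /uniform_nbhs[E [entE EP]].
move: entE; rewrite -entourage_ballE => -[e /= e0 eE].
apply: filterS (near_Kantorovich_dist beta_gt0 q_gt0 Cf e0) => n Kn.
by apply: EP => y _; apply: eE; exact: Kn.
Qed.
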